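(* Let $\Bbbk$ be a field of characteristic $0$ and let $\Lambda$ be a Legendrian knot in $(\mathbb{R}^3,\ker(dz-y\,dx))$ with a single base point. The $L_\infty$ structure $\{\ell_k\}_{k\ge1}$ on $\mathcal{A}^{\mathrm{comm}}=\Bbbk[q_1,\dots,q_n,t^{\pm1}]$ (with its distinguished generators $q_1,\dots,q_n,t^{\pm1}$) determines the differential $d:\mathcal{A}^{\mathrm{comm}}\to\mathcal{A}_{\mathrm{SFT}}^{\mathrm{comm}}$, $d(x)=\{h,x\}-\delta x$. That is, if two such knots have Reeb chords identified so that their graded generators $q_1,\dots,q_n,t^{\pm1}$ correspond and their operations $\ell_k$ agree for all $k\ge1$, then their maps $d:\mathcal{A}^{\mathrm{comm}}\to\mathcal{A}_{\mathrm{SFT}}^{\mathrm{comm}}$ agree.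
   Context: Setting. $\Pi_{xy}:\mathbb{R}^3\to\mathbb{R}^2$ is the projection to the oriented $(x,y)$-plane. $\Lambda$ is an oriented Legendrian knot with one base point $\bullet$, such that the only singularities of $\Pi_{xy}(\Lambda)$ are transverse double points away from $\bullet$. The crossings are the Reeb chords $a_1,\dots,a_n$; $a_j^+$ (resp. $a_j^-$) is the endpoint of $a_j$ with larger (resp. smaller) $z$. $\star\in\Lambda$ is a marked point immediately preceding $\bullet$ along the orientation. Put $\mathcal{S}=\{q_1,p_1,\dots,q_n,p_n,t^{\pm1}\}$. Capping paths and grading. $\gamma_t$ is the path once around $\Lambda$ from $\bullet$ to $\bullet$ following the orientation; $\gamma_j^\pm$ is the embedded path from $\bullet$ to $a_j^\pm$ following the orientation. With $r$ the real number of counterclockwise revolutions of the tangent vector of the $xy$-projection of a path, $|t^{\pm1}|=\mp2r(\gamma_t)$, $|q_j|=\lfloor2(r(\gamma_j^-)-r(\gamma_j^+))\rfloor$, $|p_j|=\lfloor2(r(\gamma_j^+)-r(\gamma_j^-))\rfloor$. Algebras (over $\Bbbk$). $\mathcal{A}^{\mathrm{comm}}=\Bbbk[q_1,\dots,q_n,t^{\pm1}]$, graded commutative; $\mathcal{A}_{\mathrm{SFT}}^{\mathrm{comm}}$ is the graded commutative algebra generated by $\mathcal{S}$ ($tt^{-1}=1$), completed with respect to the number of $p$'s (formal sums $\sum_kz_k$ with every word of $z_k$ containing at least $k$ $p$'s). $\Pi:\mathcal{A}_{\mathrm{SFT}}^{\mathrm{comm}}\to\mathcal{A}^{\mathrm{comm}}$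 annihilates words containing $p$'s and is the identity on words without $p$'s. Hamiltonian. $\Delta(\Lambda)$ is the set of maps $\Delta$ from $D^2$ with any number of boundary marked points to $\mathbb{R}^2$, up to reparametrization, that are continuous, orientation-preserving immersions away from the boundary marked points, with $\Delta(\partial D^2)\subset\Pi_{xy}(\Lambda)$, and that send each boundary marked point to a crossing and a neighborhood of it injectively to one of the four quadrants there. A quadrant at $a_j$ is labeled $p_j$ if, following its boundary counterclockwise, one arrives at the crossing along the lower strand and leaves along the upper strand, and is labeled $q_j$ otherwise. Going counterclockwise around $\partial\Delta$, record the labels of the corners, and $t$ (resp. $t^{-1}$) when passing $\star$ along (resp. against) the orientation of $\Lambda$; this gives a cyclic word $v_1\cdots v_k$, written with $v_k$ a $p$ or $q$. Put $\epsilon_i(\Delta)=+1$ if $v_i=t^{\pm1}$; if $v_i$ is a corner at a positive crossing, $\epsilon_i(\Delta)=+1$ if the quadrant lies to the left of both oriented strands and $-1$ for the other three quadrants; if $v_i$ is a corner at a negative crossing, $\epsilon_i(\Delta)=-1$ if the quadrant is the $p$-quadrant whose counterclockwise outgoing edge runs against the orientation of $\Lambda$, and $+1$ for the other three. Put $\epsilon'(\Delta;v_k)=\pm1$ according to whether $\partial\Delta$ right after the corner $v_k$ agrees or disagrees with the orientation of $\Lambda$. Then $\tilde w(\Delta)=\epsilon_1(\Delta)\cdots\epsilon_k(\Delta)\epsilon'(\Delta;v_k)\,v_1\cdots v_k$, $h_k=\sum\tilde w(\Delta)$ over those $\Delta$ whose word contains exactly $k$ $p$'s, and $h=\sum_{k\ge1}h_k$.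 SFT bracket. $\{\cdot,\cdot\}$ on $\mathcal{A}_{\mathrm{SFT}}^{\mathrm{comm}}$ is the bilinear map of degree $+1$ with $\{p_i,q_j\}=-\{q_j,p_i\}=\delta_{ij}$, all other brackets of generators $0$, $\{y,x\}=(-1)^{|x||y|+|x|+|y|}\{x,y\}$, $\{x,yz\}=\{x,y\}z+(-1)^{(|x|+1)|y|}y\{x,z\}$ and $\{xy,z\}=x\{y,z\}+(-1)^{|y|(|z|+1)}\{x,z\}y$. String coproduct. $\delta$ is the degree $-1$ derivation ($\delta(xy)=(\delta x)y+(-1)^{|x|}x\,\delta y$) of $\mathcal{A}_{\mathrm{SFT}}^{\mathrm{comm}}$ given on generators as follows. Put $\eta(a_i^-)=p_iq_i$, $\eta(a_i^+)=-q_ip_i$, and for a path $\gamma$ in $\Lambda$ let $\eta(\gamma)$ be the sum of $\eta(e)$ over Reeb chord endpoints $e$ in the interior of $\gamma$. Then $\delta t=\eta(\gamma_t)t$, $\delta t^{-1}=-t^{-1}\eta(\gamma_t)$, $\delta q_j=\eta(\gamma_j^+)q_j-(-1)^{|q_j|}q_j\eta(\gamma_j^-)+c_j$ with $c_j=-q_jp_jq_j$ if $|q_j|$ is even and $0$ otherwise, and $\delta p_j=\eta(\gamma_j^-)p_j-(-1)^{|p_j|}p_j\eta(\gamma_j^+)+c_j'$ with $c_j'=p_jq_jp_j$ if $|q_j|$ is odd and $0$ otherwise. $L_\infty$ structure for a knot with one base point. For $x_1,\dots,x_k\in\mathcal{A}^{\mathrm{comm}}$, $\ell_k(x_1,\dots,x_k)=(-1)^{|x_{k-1}|+|x_{k-3}|+\cdots}\,\Pi\{\cdots\{\{dx_1,x_2\},x_3\},\dots,x_k\}$;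 explicitly $\ell_1(x_1)=\{h_1,x_1\}$, $\ell_2(x_1,x_2)=(-1)^{|x_1|}\{\{h_2,x_1\},x_2\}-(-1)^{|x_1|}\{\delta x_1,x_2\}$, and $\ell_k(x_1,\dots,x_k)=(-1)^{|x_{k-1}|+|x_{k-3}|+\cdots}\{\cdots\{\{h_k,x_1\},x_2\},\dots,x_k\}$ for $k\ge3$. *)

(* Defs.v *)
From HB Require Import structures.
From mathcomp Require Import all_boot all_order all_algebra.
From mathcomp Require Import all_classical all_reals all_analysis.

Set Implicit Arguments.
Unset Strict Implicit.
Unset Printing Implicit Defensive.

Import Order.TTheory GRing.Theory Num.Theory.
Import numFieldNormedType.Exports.

Local Open Scope classical_set_scope.
Local Open Scope ring_scope.

(** * Legendrian knots in (R^3, ker(dz - y dx)) with one base point *)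

Definition smooth1 (R : realType) (f : R -> R) : Prop :=
  forall m s, derivable (derive1n m f) s 1.

(** The knot is the image of the 1-periodic curve s |-> (x s, y s, z s),
    oriented by increasing s, with the base point at s = 0; [star] is the
    parameter of the marked point that precedes the base point, with no
    crossing in between.  [angle] is a continuous argument of the (nowhere
    zero) velocity of the xy-projection; only differences of its values are
    used below, so nothing depends on which lift is taken.  The Reeb chord
    a_j joins the parameters [sp j] (endpoint a_j^+) and [sm j] (a_j^-). *)
Record legendrian_knot (R : realType) (n : nat) := LegendrianKnot {
  kx : R -> R;
  ky : R -> R;
  kz : R -> R;
  angle : R -> R;
  sp : 'I_n -> R;
  sm : 'I_n -> R;
  star : R;
  kx_smooth : smooth1 kx;
  ky_smooth : smooth1 ky;
  kz_smooth : smooth1 kz;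
  k_periodic : forall s,
    [/\ kx (s + 1) = kx s, ky (s + 1) = ky s & kz (s + 1) = kz s];
  k_embedded : forall s s', 0 <= s < 1 -> 0 <= s' < 1 ->
    kx s = kx s' -> ky s = ky s' -> kz s = kz s' -> s = s';
  k_immersed : forall s,
    [|| derive1 kx s != 0, derive1 ky s != 0 | derive1 kz s != 0];
  k_legendrian : forall s, derive1 kz s = ky s * derive1 kx s;
  angle_continuous : continuous angle;
  angleP : forall s, exists2 r, 0 < r &
    derive1 kx s = r * cos (angle s) /\
    derive1 ky s = r * sin (angle s);
  chord_away : forall j, 0 < sp j < 1 /\ 0 < sm j < 1;
  chordP : forall j,
    [/\ kx (sp j) = kx (sm j), ky (sp j) = ky (sm j) & kz (sm j) < kz (sp j)];
  chord_complete : forall s s', 0 <= s < 1 -> 0 <= s' < 1 ->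
    kx s = kx s' -> ky s = ky s' -> kz s' < kz s ->
    exists j, s = sp j /\ s' = sm j;
  chord_double : forall i j,
    kx (sp i) = kx (sp j) -> ky (sp i) = ky (sp j) -> i = j;
  chord_transverse : forall j,
    derive1 kx (sp j) * derive1 ky (sm j)
      != derive1 ky (sp j) * derive1 kx (sm j);
  star_last : 0 < star < 1 /\ forall j, sp j < star /\ sm j < star
}.

(** [T true] is t and [T false] is t^-1. *)
Inductive letter (n : nat) := Q of 'I_n | P of 'I_n | T of bool.
Arguments T {n}.

Definition word n := seq (letter n).

Section Grading.
Variables (R : realType) (n : nat) (K : legendrian_knot R n).

Definition rotation (a b : R) : R := (angle K b - angle K a) / (2 * pi).

Definition deg (l : letter n) : int :=
  match l with
  | Q j => Num.floor (2 * (rotation 0 (sm K j) - rotation 0 (sp K j)))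
  | P j => Num.floor (2 * (rotation 0 (sp K j) - rotation 0 (sm K j)))
  | T true => Num.floor (- (2 * rotation 0 1))
  | T false => Num.floor (2 * rotation 0 1)
  end.

End Grading.

(** * The graded commutative algebras

    A monomial t^c q_1^(a_1)...q_n^(a_n) p_1^(b_1)...p_n^(b_n) is recorded by
    its exponents; those in which no odd generator is repeated form a basis of
    the graded commutative algebra generated by q_j, p_j, t, t^-1 (t has even
    degree).  An element of the completion A_SFT^comm is given by its coefficient
    function on monomials, which has finitely many nonzero values in each
    p-degree; the operations below are written coefficientwise, as sums with
    finite support.  A word stands for the product of its letters: it
    is zero if it repeats an odd letter, and otherwise the sorted monomial
    with the Koszul sign. *)

Definition mono n := (int * {ffun 'I_n -> nat} * {ffun 'I_n -> nat})%type.

Section Words.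
Variable n : nat.
Implicit Types (l : letter n) (w : word n) (m : mono n).

Definition texp m : int := m.1.1.
Definition qexp m (j : 'I_n) : nat := m.1.2 j.
Definition pexp m (j : 'I_n) : nat := m.2 j.

Definition isQ (j : 'I_n) l := if l is Q i then i == j else false.
Definition isP (j : 'I_n) l := if l is P i then i == j else false.
Definition tval l : int :=
  match l with T true => 1 | T false => -1 | _ => 0 end.

Definition mono_of_word w : mono n :=
  (\sum_(l <- w) tval l,
   [ffun j => count (isQ j) w],
   [ffun j => count (isP j) w]).

Definition word_of_mono m : word n :=
  nseq `|texp m|%N (T (0 <= texp m))
  ++ flatten [seq nseq (qexp m j) (Q j) | j <- enum 'I_n]
  ++ flatten [seq nseq (pexp m j) (P j) | j <- enum 'I_n].

Definition rank l : nat :=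
  match l with T _ => 0 | Q j => j.+1 | P j => (n + j).+1 end.

End Words.

Section Algebra.
Variables (k : fieldType) (n : nat) (dg : letter n -> int).
Implicit Types (l : letter n) (v w : word n) (m : mono n).

Definition oddz (d : int) : bool := odd `|d|%N.
Definition sg (d : int) : k := (-1) ^+ `|d|%N.
Definition wdeg w : int := \sum_(l <- w) dg l.

Fixpoint inversions w : nat :=
  if w is l :: w' then
    ((if oddz (dg l)
      then count (fun l' => oddz (dg l') && (rank l' < rank l)%N) w' else 0)
     + inversions w')%N
  else 0%N.

Definition admissible m : bool :=
  [forall j, (oddz (dg (Q j)) ==> (qexp m j <= 1)%N)
          && (oddz (dg (P j)) ==> (pexp m j <= 1)%N)].

Definition formal_series := mono n -> k.

Definition word_coef w : formal_series := fun m =>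
  if (mono_of_word w == m) && admissible m then (-1) ^+ inversions w else 0.

(** Membership in A^comm = k[q_1, ..., q_n, t, t^-1]. *)
Definition in_Acomm (x : formal_series) : Prop :=
  (forall m, x m != 0 -> admissible m /\ forall j, pexp m j = 0%N) /\
  finite_set [set m | x m != 0].

(** The projection Pi, annihilating words that contain p's. *)
Definition Pi (x : formal_series) : formal_series := fun m =>
  if [forall j, pexp m j == 0%N] then x m else 0.

(** Finite formal linear combinations of words. *)
Definition comb := seq (k * word n).

Definition comb_coef (c : comb) : formal_series := fun m =>
  \sum_(a <- c) a.1 * word_coef a.2 m.

(** a * u * c * v *)
Definition sandwich (a : k) (u : word n) (c : comb) (v : word n) : comb :=
  [seq (a * b.1, u ++ b.2 ++ v) | b <- c].

(** ** The SFT bracket, extended from generators by the two Leibniz rules *)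

Definition bracket_gen l l' : comb :=
  match l, l' with
  | P i, Q j => if i == j then [:: (1, [::])] else [::]
  | Q j, P i => if i == j then [:: (-1, [::])] else [::]
  | _, _ => [::]
  end.

Fixpoint bracket_letter l w : comb :=
  if w is l' :: w' then
    sandwich 1 [::] (bracket_gen l l') w'
    ++ sandwich (sg ((dg l + 1) * dg l')) [:: l'] (bracket_letter l w') [::]
  else [::].

Fixpoint bracket_word v w : comb :=
  if v is l :: v' then
    sandwich 1 [:: l] (bracket_word v' w) [::]
    ++ sandwich (sg (wdeg v' * (wdeg w + 1))) [::] (bracket_letter l w) v'
  else [::].

Definition bracket (x y : formal_series) : formal_series := fun m =>
  \sum_(a \in [set: mono n * mono n]) x a.1 * y a.2 *
    comb_coef (bracket_word (word_of_mono a.1) (word_of_mono a.2)) m.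

(** The linear map x |-> (-1)^|x| x. *)
Definition twist (x : formal_series) : formal_series := fun m =>
  sg (wdeg (word_of_mono m)) * x m.

(** Applies the sign (-1)^(|x_(k-1)| + |x_(k-3)| + ...) to x_1, ..., x_k,
    extended multilinearly from homogeneous arguments. *)
Fixpoint alt_twist (s : seq formal_series) : seq formal_series :=
  if s is x :: s' then (if odd (size s') then twist x else x) :: alt_twist s'
  else [::].

End Algebra.

(** * The string coproduct *)

Section StringCoproduct.
Variables (R : realType) (k : fieldType) (n : nat) (K : legendrian_knot R n).

(** [eta a b] is eta of the path of K over the parameters in [a, b]. *)
Definition eta (a b : R) : comb k n :=
  flatten [seq (if a < sm K j < b then [:: (1, [:: P j; Q j])] else [::])
            ++ (if a < sp K j < b then [:: (-1, [:: Q j; P j])] else [::])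
          | j <- enum 'I_n].

Definition delta_gen (l : letter n) : comb k n :=
  match l with
  | T true => sandwich 1 [::] (eta 0 1) [:: T true]
  | T false => sandwich (-1) [:: T false] (eta 0 1) [::]
  | Q j =>
      sandwich 1 [::] (eta 0 (sp K j)) [:: Q j]
      ++ sandwich (- sg k (deg K (Q j))) [:: Q j] (eta 0 (sm K j)) [::]
      ++ (if oddz (deg K (Q j)) then [::] else [:: (-1, [:: Q j; P j; Q j])])
  | P j =>
      sandwich 1 [::] (eta 0 (sm K j)) [:: P j]
      ++ sandwich (- sg k (deg K (P j))) [:: P j] (eta 0 (sp K j)) [::]
      ++ (if oddz (deg K (Q j)) then [:: (1, [:: P j; Q j; P j])] else [::])
  end.

Fixpoint delta_word (w : word n) : comb k n :=
  if w is l :: w' then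
    sandwich 1 [::] (delta_gen l) w'
    ++ sandwich (sg k (deg K l)) [:: l] (delta_word w') [::]
  else [::].

Definition delta (x : formal_series k n) : formal_series k n := fun m =>
  \sum_(a \in [set: mono n])
    x a * comb_coef (deg K) (delta_word (word_of_mono a)) m.

End StringCoproduct.

(** * Immersed disks *)

(** [Corner j lu ll] is a corner in the quadrant at the crossing of a_j that
    lies to the left (or else the right) of the upper strand as told by [lu],
    and of the lower strand as told by [ll].  [Pass b] is a passage through
    the marked point [star], along the orientation iff [b]. *)
Inductive event (n : nat) := Corner of 'I_n & bool & bool | Pass of bool.
Arguments Pass {n}.

HB.instance Definition _ n := gen_eqMixin (event n).

(** The map from D^2 is represented by a map on the whole plane of which only
    the germ along D^2 matters; [devents] lists the corners and the passages
    through [star] with their angles on the boundary circle. *)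
Record disk (R : realType) (n : nat) := Disk {
  dmap : R * R -> R * R;
  devents : seq (R * event n)
}.

Section Disks.
Variables (R : realType) (n : nat).

Definition cross (a b : R * R) : R := a.1 * b.2 - a.2 * b.1.
Definition unit_disk : set (R * R) := [set v | v.1 ^+ 2 + v.2 ^+ 2 <= 1].
Definition unit_circle : set (R * R) := [set v | v.1 ^+ 2 + v.2 ^+ 2 = 1].
Definition cis (a : R) : R * R := (cos a, sin a).

Definition partial (f : R * R -> R) (s : seq bool) : R * R -> R :=
  foldr (fun b (g : R * R -> R) =>
    'D_(if b then ((1, 0) : R * R) else (0, 1)) g) f s.

Definition smooth_near (f : R * R -> R) (v : R * R) : Prop :=
  \forall v' \near v, forall s, differentiable (partial f s) v'.

Definition jacobian (u : R * R -> R * R) (v : R * R) : R :=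
  cross ('D_((1, 0) : R * R) u v) ('D_((0, 1) : R * R) u v).

Variable K : legendrian_knot R n.

Definition proj (s : R) : R * R := (kx K s, ky K s).
Definition velocity (s : R) : R * R :=
  (derive1 (kx K) s, derive1 (ky K) s).

Definition upper (j : 'I_n) : R * R := velocity (sp K j).
Definition lower (j : 'I_n) : R * R := velocity (sm K j).

(** Points within [e] of the strand through parameter [s0] and weakly to its
    left ([left] true) or right: displacements of the points of the strand
    along the normal direction at [s0]. *)
Definition half_nbhd (s0 : R) (left : bool) (e : R) : set (R * R) :=
  [set v | exists s r, [/\ `|s - s0| < e, 0 <= r < e &
    v = proj s + (if left then r else - r)
                   *: ((- (velocity s0).2, (velocity s0).1) : R * R)]].

(** For small [e], a neighborhood of the crossing in the closed quadrant. *)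
Definition quadrant (j : 'I_n) (lu ll : bool) (e : R) : set (R * R) :=
  half_nbhd (sp K j) lu e `&` half_nbhd (sm K j) ll e.

(** Whether the edge of the quadrant on the upper (lower) strand leaves the
    crossing along the orientation of K: it is the half-strand lying on the
    same side of the other strand as the quadrant. *)
Definition upper_fwd (j : 'I_n) (lu ll : bool) : bool :=
  (0 < cross (lower j) (upper j)) == ll.
Definition lower_fwd (j : 'I_n) (lu ll : bool) : bool :=
  (0 < cross (upper j) (lower j)) == lu.

Definition edge (fwd : bool) (v : R * R) : R * R := if fwd then v else - v.

(** The boundary of the quadrant, followed counterclockwise, leaves the
    crossing along the first of its two edges in counterclockwise order. *)
Definition p_quadrant (j : 'I_n) (lu ll : bool) : bool :=
  0 < cross (edge (upper_fwd j lu ll) (upper j))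
            (edge (lower_fwd j lu ll) (lower j)).

Definition outgoing_fwd (j : 'I_n) (lu ll : bool) : bool :=
  if p_quadrant j lu ll then upper_fwd j lu ll else lower_fwd j lu ll.

Definition positive_crossing (j : 'I_n) : bool :=
  0 < cross (upper j) (lower j).

Definition event_letter (e : event n) : letter n :=
  match e with
  | Corner j lu ll => if p_quadrant j lu ll then P j else Q j
  | Pass b => T b
  end.

Definition is_corner (e : event n) : bool :=
  if e is Corner _ _ _ then true else false.

Definition is_p_corner (e : event n) : bool :=
  if e is Corner j lu ll then p_quadrant j lu ll else false.

Definition corners (D : disk R n) : set (R * R) :=
  [set v | exists a e, [/\ (a, e) \in devents D, is_corner e & v = cis a]].

Definition corner_at (u : R * R -> R * R) (a : R) (j : 'I_n) (lu ll : bool)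
    : Prop :=
  [/\ u (cis a) = proj (sp K j),
      exists2 V, nbhs (cis a) V & set_inj (V `&` unit_disk) u &
      forall e, 0 < e ->
        \forall v \near cis a, unit_disk v -> quadrant j lu ll e (u v)].

Definition pass_at (u : R * R -> R * R) (a : R) (b : bool) : Prop :=
  u (cis a) = proj (star K) /\
  let c := 'D_((- sin a, cos a) : R * R) u (cis a) in
  let v := velocity (star K) in
  b = (0 < c.1 * v.1 + c.2 * v.2).

Definition event_at (u : R * R -> R * R) (a : R) (e : event n) : Prop :=
  match e with
  | Corner j lu ll => corner_at u a j lu ll
  | Pass b => pass_at u a b
  end.

(** The disks of Delta(K) with at least one corner.  The events are listed
    counterclockwise from angle 0, and, up to a rotation of D^2, the last one
    is a corner. *)
Definition is_disk (D : disk R n) : Prop :=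
  let u := dmap D in
  [/\ {within unit_disk, continuous u},
      forall v, unit_disk v -> ~ corners D v ->
        [/\ smooth_near (fun v' => (u v').1) v,
            smooth_near (fun v' => (u v').2) v & 0 < jacobian u v],
      forall v, unit_circle v -> exists s, u v = proj s,
      [/\ sorted <%R [seq c.1 | c <- devents D],
          forall a e, (a, e) \in devents D -> 0 <= a < 2 * pi /\ event_at u a e
        & forall a, 0 <= a < 2 * pi -> u (cis a) = proj (star K) ->
            exists b, (a, Pass b) \in devents D]
    & exists c s, devents D = rcons s c /\ is_corner c.2].

(** Reparametrizations are homeomorphisms of D^2 matching the corners; away
    from the corners they are automatically orientation-preserving
    diffeomorphisms, being locally lifts of the identity through immersions. *)
Definition same_disk (D D' : disk R n) : Prop :=
  exists f g : R * R -> R * R,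
  [/\ {within unit_disk, continuous f} /\ {within unit_disk, continuous g},
      forall v, unit_disk v ->
        [/\ unit_disk (f v), unit_disk (g v), g (f v) = v & f (g v) = v],
      f @` corners D' = corners D &
      forall v, unit_disk v -> dmap D' v = dmap D (f v)].

Definition disk_classes : set (set (disk R n)) :=
  [set C | exists2 D, is_disk D &
    C = [set D' | is_disk D' /\ same_disk D D']].

Definition p_count (D : disk R n) : nat :=
  count (fun c => is_p_corner c.2) (devents D).

Variable k : fieldType.

Definition corner_sign (e : event n) : k :=
  match e with
  | Corner j lu ll =>
      if positive_crossing j then (if lu && ll then 1 else -1)
      else (if p_quadrant j lu ll && ~~ outgoing_fwd j lu ll then -1 else 1)
  | Pass _ => 1
  end.

Definition outgoing_sign (e : event n) : k :=
  if e is Corner j lu ll then (if outgoing_fwd j lu ll then 1 else -1) else 1.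

Definition disk_weight (D : disk R n) : formal_series k n := fun m =>
  \prod_(c <- devents D) corner_sign c.2
  * outgoing_sign (last (Pass true) [seq c.2 | c <- devents D])
  * word_coef k (deg K) [seq event_letter c.2 | c <- devents D] m.

(** The class of a disk contributes the weight of a chosen representative
    (weights are invariant under reparametrization, including the choice of
    the corner that comes last). *)
Definition class_rep (C : set (disk R n)) : {classic disk R n} :=
  xget (Disk (fun=> (0, 0)) [::] : {classic disk R n}) C.

Definition hamiltonian_part (i : nat) : formal_series k n := fun m =>
  \sum_(C \in [set C | disk_classes C /\ p_count (class_rep C) = i])
    disk_weight (class_rep C) m.

Definition hamiltonian : formal_series k n := fun m =>
  \sum_(i \in [set i : nat | (1 <= i)%N]) hamiltonian_part i m.

(** * The differential and the L-infinity operations *)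

Definition differential (x : formal_series k n) : formal_series k n := fun m =>
  bracket (deg K) hamiltonian x m - delta K x m.

Definition ell (i : nat) (x : i.-tuple (formal_series k n)) : formal_series k n :=
  if alt_twist (deg K) x is y :: s
  then Pi (foldl (bracket (deg K)) (differential y) s) else fun=> 0.

End Disks.

(* Main.v *)
Require Import Defs.
From HB Require Import structures.
From mathcomp Require Import all_boot all_order all_algebra.
From mathcomp Require Import all_classical all_reals all_analysis.
From mathcomp Require Import ring.

Set Implicit Arguments.
Unset Strict Implicit.
Unset Printing Implicit Defensive.

Import Order.TTheory GRing.Theory Num.Theory.
Local Open Scope ring_scope.

(** Bracketing with q_j on the right acts on p-degree like the derivative with
    respect to p_j, since q_j only pairs with p_j.  Hence, for z = dx, the
    coefficient of a monomial t^c q^a p^b in z is read off, up to a sign and the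
    factor b_1! ... b_n!, from the coefficient of t^c q^a in
    Pi {... {{z, q_(i_1)}, q_(i_2)}, ...}, where q_j is repeated b_j times; this
    is an operation ell_k evaluated at x and generators.  The factorials only
    occur for even p_j, and are invertible in characteristic 0. *)

HB.instance Definition _ n := gen_eqMixin (letter n).

(** * Parity of degrees and Koszul signs *)

Lemma oddzD1 (d : int) : oddz (d + 1) = ~~ oddz d.
Proof.
case: d => m; first by rewrite -PoszD addn1.
rewrite (_ : Negz m + 1 = - m%:Z); last first.
  by rewrite NegzE -addn1 PoszD opprD addrNK.
by rewrite /oddz abszN /= negbK.
Qed.

Lemma oddzN (d : int) : oddz (- d) = oddz d.
Proof. by rewrite /oddz abszN. Qed.

Lemma sg_even (k : fieldType) (d : int) : ~~ oddz d -> sg k d = 1.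
Proof. by rewrite /sg /oddz -signr_odd => /negbTE ->. Qed.

Lemma sg_sq (k : fieldType) (d : int) : sg k d * sg k d = 1.
Proof. by rewrite /sg -expr2 sqrr_sign. Qed.

(** * Monomials and their sorted words *)

Section Monomials.
Variable n : nat.
Implicit Types (m : mono n) (v w : word n) (i j : 'I_n).

(** Multiplication by p_j at the level of exponents; the result may be inadmissible when p_j is
    odd. *)
Definition addp j m : mono n := (m.1, [ffun i => (m.2 i + (i == j))%N]).

Lemma addp_inj j : injective (addp j).
Proof.
move=> [m b] [m' b'] [-> /ffunP eb]; congr pair; apply/ffunP => i.
by have := eb i; rewrite !ffunE => /addIn.
Qed.

Lemma foldr_addp (s : seq 'I_n) m :
  foldr addp m s = (m.1, [ffun i => (m.2 i + count_mem i s)%N]).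
Proof.
elim: s => [|j s IH] /=.
  by case: m => a b /=; congr pair; apply/ffunP => i; rewrite ffunE addn0.
rewrite IH /addp /=; congr pair; apply/ffunP => i.
by rewrite !ffunE -addnA [in RHS]eq_sym [(_ + (i == j))%N]addnC.
Qed.

Lemma count_flatten_nseq (L : Type) (f : 'I_n -> nat) (g : 'I_n -> L)
    (p : pred L) :
  count p (flatten [seq nseq (f j) (g j) | j <- enum 'I_n])
  = (\sum_j p (g j) * f j)%N.
Proof.
rewrite count_flatten sumnE -map_comp big_map big_enum.
by apply: eq_bigr => j _; rewrite /= count_nseq.
Qed.

Lemma sum_eq_muln (f : 'I_n -> nat) i : (\sum_j (j == i) * f j = f i)%N.
Proof.
rewrite (bigD1 i) //= eqxx mul1n big1 ?addn0 // => j /negbTE ->.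
by rewrite mul0n.
Qed.

Lemma sum_mem_flatten_nseq (V : nmodType) (L : Type) (f : 'I_n -> nat)
    (g : 'I_n -> L) (F : L -> V) :
  (forall j, F (g j) = 0) ->
  \sum_(l <- flatten [seq nseq (f j) (g j) | j <- enum 'I_n]) F l = 0.
Proof.
move=> F0; rewrite big_flatten big_map big1 // => j _.
by rewrite big_nseq F0 iter_addr_0 mul0rn.
Qed.

Lemma word_of_monoK m : mono_of_word (word_of_mono m) = m.
Proof.
case: m => [[c a] b]; rewrite /mono_of_word /word_of_mono /texp /qexp /pexp /=.
congr (_, _, _).
- rewrite !big_cat /= !sum_mem_flatten_nseq // !addr0 big_nseq iter_addr_0.
  case: c => e /=; first by rewrite -mulr_natr mul1r natz.
  by rewrite mulNrn NegzE natz.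
- apply/ffunP => i; rewrite ffunE !count_cat !count_flatten_nseq count_nseq /=.
  by rewrite sum_eq_muln mul0n add0n [X in (_ + X)%N]big1 // addn0.
- apply/ffunP => i; rewrite ffunE !count_cat !count_flatten_nseq count_nseq /=.
  by rewrite sum_eq_muln mul0n big1 // !add0n.
Qed.

Lemma mono_of_word_perm v w :
  perm_eq v w -> mono_of_word v = mono_of_word w.
Proof.
move=> vw; rewrite /mono_of_word (perm_big _ vw) /=.
by congr (_, _, _); apply/ffunP => i; rewrite !ffunE (permP vw).
Qed.

Lemma mono_of_word_P j w :
  mono_of_word (P j :: w) = addp j (mono_of_word w).
Proof.
rewrite /mono_of_word /addp /= big_cons add0r; congr (_, _, _); apply/ffunP => i.
by rewrite !ffunE /= addnC eq_sym.
Qed.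

Lemma flatten_nseq_eq (L : Type) (g : 'I_n -> L) (f : 'I_n -> nat) j s :
    (forall i, f i = (j == i)) -> uniq s ->
  flatten [seq nseq (f i) (g i) | i <- s] = if j \in s then [:: g j] else [::].
Proof.
move=> fE; elim: s => //= i s IH /andP [nis /IH ->]; rewrite fE in_cons.
by case: eqVneq nis => [-> /negbTE -> |].
Qed.

Lemma word_of_mono_Q j : word_of_mono (mono_of_word [:: Q j]) = [:: Q j].
Proof.
rewrite /word_of_mono /texp /qexp /pexp /= big_seq1 /=.
rewrite [X in _ ++ X](_ : _ = [::]); last first.
  by elim: (enum 'I_n) => //= i s ->; rewrite !ffunE.
rewrite cats0 (@flatten_nseq_eq _ _ _ j) ?enum_uniq ?mem_enum // => i.
by rewrite ffunE /= addn0.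
Qed.

End Monomials.

(** * Bracketing with a single q_j *)

Section Bracket.
Variables (k : fieldType) (n : nat) (dg : letter n -> int).
Implicit Types (m : mono n) (v w : word n) (i j : 'I_n) (l : letter n).
Implicit Types (x y z : formal_series k n).

Lemma admissible_addp j m : admissible dg (addp j m) -> admissible dg m.
Proof.
move=> /forallP adm; apply/forallP => i; have := adm i.
rewrite /qexp /pexp /= ffunE => /andP [-> /implyP ip] /=.
by apply/implyP => /ip; apply: leq_trans; rewrite leq_addr.
Qed.

Lemma comb_coef_inadmissible (c : comb k n) m :
  ~~ admissible dg m -> comb_coef dg c m = 0.
Proof.
move=> /negbTE nadm; rewrite /comb_coef big1 // => a _.
by rewrite /word_coef nadm andbF mulr0.
Qed.

Lemma bracket_inadmissible x y m : ~~ admissible dg m -> bracket dg x y m = 0.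
Proof.
by move=> nadm; apply: fsbig1 => a _; rewrite comb_coef_inadmissible ?mulr0.
Qed.

Lemma bracket_letter_Q l j :
  bracket_letter k dg l [:: Q j] = if isP j l then [:: (1, [::])] else [::].
Proof.
by case: l => [i|i|b] //=; rewrite /sandwich /=; case: ifP; rewrite //= mulr1.
Qed.

Lemma bracket_word_cons_Q l v j :
  bracket_word k dg (l :: v) [:: Q j] =
    sandwich 1 [:: l] (bracket_word k dg v [:: Q j]) [::] ++
    (if isP j l then [:: (sg k (wdeg dg v * (dg (Q j) + 1)), v)] else [::]).
Proof.
rewrite [LHS]/(_ ++ sandwich (sg k (_ * (wdeg dg _ + 1))) [::]
  (bracket_letter k dg l _) v) bracket_letter_Q [wdeg _ [:: _]]big_seq1.
by case: (isP j l); rewrite //= mulr1.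
Qed.

Lemma size_bracket_word_Q v j :
  size (bracket_word k dg v [:: Q j]) = count (isP j) v.
Proof.
elim: v => // l v IH; rewrite bracket_word_cons_Q size_cat size_map IH /=.
by case: (isP j l); rewrite addnC.
Qed.

Lemma isP_eq l j : isP j l -> l = P j.
Proof. by case: l => //= i /eqP ->. Qed.

(** Since q_j pairs only with p_j, each term of the bracket arises by deleting one occurrence of
    p_j. *)
Lemma bracket_word_Q_perm v j c :
  c \in bracket_word k dg v [:: Q j] -> perm_eq v (P j :: c.2).
Proof.
elim: v c => // l v IH c; rewrite bracket_word_cons_Q mem_cat => /orP[].
  move=> /mapP [d /IH dv ->] /=; rewrite cats0 -cat1s.
  rewrite (perm_trans (y := [:: l] ++ P j :: d.2)) ?perm_cat2l //.
  by rewrite -[P j :: d.2]cat1s perm_catCA.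
by case: ifP => // /isP_eq -> /[!inE] /eqP ->.
Qed.

Lemma bracket_word_Q_sign v j c :
  c \in bracket_word k dg v [:: Q j] -> c.1 != 0.
Proof.
elim: v c => // l v IH c; rewrite bracket_word_cons_Q mem_cat => /orP[].
  by move=> /mapP [d /IH dv ->] /=; rewrite mul1r.
by case: ifP => // _ /[!inE] /eqP -> /=; rewrite signr_eq0.
Qed.

(** The Leibniz sign is trivial because |q_j| + 1 is even, and deleting an even p_j leaves the
    Koszul sign unchanged. Hence the terms cannot cancel. *)
Lemma bracket_word_Q_even v j c :
    oddz (dg (Q j)) -> ~~ oddz (dg (P j)) ->
    c \in bracket_word k dg v [:: Q j] ->
  c.1 = 1 /\ inversions dg c.2 = inversions dg v.
Proof.
move=> oddQ evenP; elim: v c => // l v IH c.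
rewrite bracket_word_cons_Q mem_cat => /orP[].
  move=> /mapP [d dv ->] /=; have [-> inv] := IH d dv.
  rewrite mul1r cats0 /= inv; split=> //; congr (_ + _)%N.
  case: ifP => // _; rewrite (permP (bracket_word_Q_perm dv)) /=.
  by rewrite (negbTE evenP).
case: ifP => // /isP_eq -> /[!inE] /eqP -> /=; rewrite (negbTE evenP) add0n.
split=> //; apply: sg_even.
by rewrite /oddz abszM oddM -!/(oddz _) oddzD1 oddQ andbF.
Qed.

Lemma comb_coef_bracket_Q_neq v j m :
  mono_of_word v != addp j m ->
  comb_coef dg (bracket_word k dg v [:: Q j]) m = 0.
Proof.
move=> ne; rewrite /comb_coef big_seq big1 // => c cv.
rewrite /word_coef; case: eqP => [e|_]; last by rewrite mulr0.
move: ne; rewrite (mono_of_word_perm (bracket_word_Q_perm cv)).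
by rewrite mono_of_word_P e eqxx.
Qed.

Definition qgen j : formal_series k n :=
  fun m => (m == mono_of_word [:: Q j])%:R.

(** The scalar by which {-, q_j} carries the coefficient at p_j m to the one at m. *)
Definition lower_coef j m : k :=
  comb_coef dg (bracket_word k dg (word_of_mono (addp j m)) [:: Q j]) m.

(** Only the pair formed by p_j m and q_j contributes to the coefficient at m. The factor [a] makes
    room for the signs of [alt_twist]. *)
Lemma bracket_qgen z a j m :
  bracket dg z (fun m' => a * qgen j m') m
  = a * lower_coef j m * z (addp j m).
Proof.
rewrite /bracket -(fsbig_widen [set (addp j m, mono_of_word [:: Q j])]%classic).
- by rewrite fsbig_set1 /= /qgen eqxx mulr1 word_of_mono_Q -mulrA mulrC.
- by [].
move=> [b c] [_ /= ne]; rewrite /qgen; case: eqP => [ec|_]; last first.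
  by rewrite !mulr0 mul0r.
rewrite ec word_of_mono_Q comb_coef_bracket_Q_neq ?mulr0 //.
by rewrite word_of_monoK; apply/eqP => eb; apply: ne; rewrite eb ec.
Qed.

(** * Iterated brackets and recovery of coefficients *)

Hypothesis char0 : [pchar k]%R =i pred0.
Hypothesis parityP : forall j, oddz (dg (P j)) = ~~ oddz (dg (Q j)).

(** For |q_j| odd, p_j is even and all the terms of the bracket have the same
    sign; for |q_j| even, p_j is odd and only one term occurs. *)
Lemma lower_coef_neq0 j m :
  admissible dg (addp j m) -> lower_coef j m != 0.
Proof.
move=> adm; rewrite /lower_coef /comb_coef.
set v := word_of_mono _.
have size_v : size (bracket_word k dg v [:: Q j]) = (m.2 j).+1.
  rewrite size_bracket_word_Q; have := congr1 (fun m' => m'.2 j)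
    (word_of_monoK (addp j m)).
  by rewrite /= !ffunE eqxx addn1.
have word_coefE c : c \in bracket_word k dg v [:: Q j] ->
    word_coef k dg c.2 m = (-1) ^+ inversions dg c.2.
  move=> cv; rewrite /word_coef (admissible_addp adm) andbT.
  case: eqP => // -[]; apply: (@addp_inj _ j); rewrite -mono_of_word_P.
  by rewrite -(mono_of_word_perm (bracket_word_Q_perm cv)) word_of_monoK.
have [oddQ|evenQ] := boolP (oddz (dg (Q j))).
- rewrite big_seq (eq_bigr (fun=> (-1) ^+ inversions dg v)); last first.
    move=> c cv; rewrite word_coefE //.
    have evenP : ~~ oddz (dg (P j)) by rewrite parityP oddQ.
    by have [-> ->] := bracket_word_Q_even oddQ evenP cv; rewrite mul1r.
  (* Up to sign the sum is the exponent [m.2 j] plus one, nonzero in characteristic 0. *)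
  rewrite -big_seq big_const_seq count_predT size_v.
  rewrite iter_addr_0 -mulr_natr mulf_neq0 ?signr_eq0 //.
  by have /pcharf0P -> := char0.
(* Here p_j is odd, so admissibility of [addp j m] leaves no p_j in [m], and the bracket has a
   single term. *)
- have m0 : m.2 j = 0%N.
    have /forallP /(_ j) /andP [_] := adm.
    rewrite parityP evenQ /pexp /= ffunE eqxx addn1 ltnS leqn0.
    by move/eqP.
  move: size_v word_coefE (@bracket_word_Q_sign v j); rewrite m0.
  case: (bracket_word _ _ _ _) => [|c []] // _ wc sc.
  rewrite big_seq1 wc ?mem_head // mulf_neq0 ?signr_eq0 //.
  by apply: sc; rewrite mem_head.
Qed.

Lemma twist_qgen j :
  twist dg (qgen j) = fun m => sg k (dg (Q j)) * qgen j m.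
Proof.
apply/funext => m; rewrite /twist /qgen; case: eqP => [->|_].
  by rewrite word_of_mono_Q /wdeg big_seq1.
by rewrite !mulr0.
Qed.

Lemma twistK : involutive (@twist k n dg).
Proof.
by move=> x; apply/funext => m; rewrite /twist mulrA sg_sq mul1r.
Qed.

(** The scalar [c] is a product of values of [lower_coef] and twist signs. It does not depend on
    [z], so two series can be compared through it; it is nonzero because admissibility passes to
    divisors. *)
Lemma foldl_bracket_qgen (s : seq 'I_n) :
  exists c : mono n -> k,
    (forall z m, foldl (bracket dg) z (alt_twist dg (map qgen s)) m
       = c m * z (foldr (@addp n) m s)) /\
    (forall m, admissible dg (foldr (@addp n) m s) -> c m != 0).
Proof.
elim: s => [|j s [c [cE cN]]] /=.
  by exists (fun=> 1); split=> [z m|m _]; rewrite ?mul1r ?oner_eq0.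
(* The sign that [alt_twist] puts on the first generator. *)
pose a : k := if odd (size s) then sg k (dg (Q j)) else 1.
have a_neq0 : a != 0 by rewrite /a; case: ifP; rewrite ?oner_eq0 ?signr_eq0.
exists (fun m => c m * (a * lower_coef j (foldr (@addp n) m s))).
split=> [z m|m adm].
- rewrite cE size_map.
  rewrite (_ : (if _ then _ else _) = fun m' => a * qgen j m').
    by rewrite bracket_qgen -!mulrA.
  rewrite /a; case: ifP => _; first by rewrite twist_qgen.
  by apply/funext => m'; rewrite mul1r.
- rewrite !mulf_neq0 ?lower_coef_neq0 //.
  by apply: cN; apply: admissible_addp adm.
Qed.

(** Enough brackets lower any admissible monomial to a p-free one, whose coefficient [Pi] keeps, and
    the scalar relating the two coefficients is invertible. Inadmissible coefficients are settled by
    the support hypotheses. *)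
Lemma Pi_foldl_bracket_inj z1 z2 :
    (forall m, ~~ admissible dg m -> z1 m = 0) ->
    (forall m, ~~ admissible dg m -> z2 m = 0) ->
    (forall s : seq 'I_n,
       Pi (foldl (bracket dg) z1 (alt_twist dg (map qgen s)))
       = Pi (foldl (bracket dg) z2 (alt_twist dg (map qgen s)))) ->
  z1 = z2.
Proof.
move=> supp1 supp2 eqz; apply/funext => m.
have [adm|nadm] := boolP (admissible dg m); last by rewrite supp1 ?supp2.
(* Each j is listed as often as p_j occurs in [m]; [m0] is [m] with its p's removed. *)
pose s := flatten [seq nseq (m.2 j) j | j <- enum 'I_n].
pose m0 : mono n := (m.1, [ffun=> 0%N]).
have sE : foldr (@addp n) m0 s = m.
  rewrite foldr_addp; case: m @s @m0 {adm} => a b s m0; congr pair.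
  apply/ffunP => i; rewrite !ffunE add0n /s count_flatten_nseq.
  by rewrite sum_eq_muln.
have [c [cE cN]] := foldl_bracket_qgen s.
have := congr1 (fun z => z m0) (eqz s); rewrite /Pi.
have -> : [forall j, pexp m0 j == 0%N] by apply/forallP => j; rewrite /pexp ffunE.
by rewrite !cE sE; apply: mulfI; apply: cN; rewrite sE.
Qed.

Lemma in_Acomm_qgen j : in_Acomm dg (qgen j).
Proof.
split=> [m|].
  rewrite /qgen; case: (m =P _) => [->|_]; last by rewrite eqxx.
  move=> _; split=> [|i]; last by rewrite /pexp ffunE.
  apply/forallP => i; rewrite /qexp /pexp !ffunE /= addn0.
  by rewrite !implybT leq_b1 implybT.
apply: (sub_finite_set (B := [set mono_of_word [:: Q j]]%classic)).
  by move=> m /=; rewrite /qgen; case: (m =P _) => // _; rewrite eqxx.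
exact: finite_set1.
Qed.

Lemma in_Acomm_twist x : in_Acomm dg x -> in_Acomm dg (twist dg x).
Proof.
have twist0 m : (twist dg x m != 0) = (x m != 0).
  by rewrite /twist mulf_eq0 signr_eq0.
move=> [supp fin]; split=> [m|]; first by rewrite twist0; exact: supp.
by apply: sub_finite_set fin => m /=; rewrite twist0.
Qed.

End Bracket.

(** * Degrees of p_j from transversality *)

Section Degrees.
Variables (R : realType) (n : nat).
Implicit Types (K : legendrian_knot R n).

Lemma sin_int_pi (d : int) : sin (d%:~R * pi) = 0 :> R.
Proof.
have sin_nat (e : nat) : sin (e%:R * pi) = 0 :> R.
  elim: e => [|e IH]; first by rewrite mul0r sin0.
  by rewrite -natr1 mulrDl mul1r sinDpi IH oppr0.
case: d => e; first exact: sin_nat.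
by rewrite NegzE mulrNz mulNr sinN -pmulrn sin_nat oppr0.
Qed.

Lemma floorN_nonint (a : R) :
  a \isn't a Num.int -> Num.floor (- a) = - Num.floor a - 1.
Proof.
move=> na; rewrite -opprD; apply: (canRL opprK); rewrite -ceilNfloor.
by rewrite ceil_floor na.
Qed.

(** The cross product of the two velocities at the crossing is this sine times a product of speeds,
    and transversality makes it nonzero. *)
Lemma angle_chord K (j : 'I_n) :
  sin (angle K (sm K j) - angle K (sp K j)) != 0.
Proof.
have [r _ [xp yp]] := angleP K (sp K j); have [r' _ [xm ym]] := angleP K (sm K j).
apply: contraNneq (chord_transverse K j) => sin0.
rewrite xp yp xm ym -subr_eq0.
rewrite (_ : _ - _ = r * r' * sin (angle K (sm K j) - angle K (sp K j))).
  by rewrite sin0 mulr0.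
by rewrite sinB; ring.
Qed.

(** Transversality makes 2(r(gamma_j^-) - r(gamma_j^+)) a non-integer, so |p_j| is
    determined by |q_j| and has the opposite parity. *)
Lemma deg_P K (j : 'I_n) : deg K (P j) = - deg K (Q j) - 1.
Proof.
rewrite /deg -opprB mulrN floorN_nonint //; apply: contra (angle_chord K j).
rewrite intrEfloor /rotation => /eqP.
set d := Num.floor _ => dE; apply/eqP.
(* Rotation numbers are angle differences over 2 pi, so an integral doubled rotation difference
   would make the angle difference a multiple of pi. *)
rewrite (_ : _ - _ = d%:~R * pi) ?sin_int_pi // dE.
have := pi_gt0 R; move: (pi : R) => p p0; field.
by rewrite gt_eqF.
Qed.

End Degrees.

(** * Recovering the differential from the operations *)

Lemma differential_inadmissible (R : realType) (k : fieldType) (n : nat)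
    (K : legendrian_knot R n) (x : formal_series k n) (m : mono n) :
  ~~ admissible (deg K) m -> differential K x m = 0.
Proof.
move=> nadm; rewrite /differential bracket_inadmissible // sub0r.
apply/eqP; rewrite oppr_eq0; apply/eqP; apply: fsbig1 => a _.
by rewrite comb_coef_inadmissible ?mulr0.
Qed.

Theorem proposition3p13 (R : realType) (k : fieldType)
    (char0 : [pchar k]%R =i pred0) (n : nat) (K1 K2 : legendrian_knot R n)
    (same_degQ : forall j : 'I_n, deg K1 (Q j) = deg K2 (Q j))
    (same_degT : forall b : bool, deg K1 (T b) = deg K2 (T b))
    (same_ell : forall (i : nat) (x : i.-tuple (formal_series k n)), (1 <= i)%N ->
       (forall a : 'I_i, in_Acomm (deg K1) (tnth x a)) ->
       ell K1 x = ell K2 x) :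
  forall x : formal_series k n, in_Acomm (deg K1) x ->
    differential K1 x = differential K2 x.
Proof.
(* The degrees of the p_j follow from those of the q_j, so both knots have the same graded SFT
   algebra. *)
have same_deg : deg K1 = deg K2.
  by apply/funext => -[j|j|b]; rewrite ?deg_P ?same_degQ ?same_degT.
move=> x xA; apply: (Pi_foldl_bracket_inj char0 (dg := deg K1)).
- by move=> j; rewrite deg_P -opprD oddzN oddzD1.
- exact: differential_inadmissible.
- by rewrite same_deg; exact: differential_inadmissible.
(* The operation twists its first argument according to the number of later ones. Twisting [x]
   beforehand cancels this, the twist being an involution, so that d is applied to [x] itself. *)
move=> s; pose y := if odd (size s) then twist (deg K1) x else x.
have yA : in_Acomm (deg K1) y.
  by rewrite /y; case: ifP => _ //; exact: in_Acomm_twist.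
have -> : x = if odd (size (map (@qgen k n) s)) then twist (deg K1) y else y.
  by rewrite size_map /y; case: (odd (size s)); rewrite ?twistK.
(* The arity is the length of [s] plus one; the empty [s] uses ell_1 and gives the p-free part of
   dx. *)
have := same_ell _ (in_tuple (y :: map (@qgen k n) s)) isT.
rewrite /ell -same_deg; apply=> a.
have : tnth (in_tuple (y :: map (@qgen k n) s)) a \in y :: map (@qgen k n) s.
  exact: mem_tnth.
rewrite in_cons => /orP [/eqP -> //|/mapP [j _ ->]].
exact: in_Acomm_qgen.
Qed.
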